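(* NCW-directed tree-width is not closed under taking butterfly minors: there exist finite simple digraphs $D$ and $D'$ such that $D'$ is a butterfly minor of $D$ and $\mathrm{NCW}(D') > \mathrm{NCW}(D)$.
   Context: All digraphs are finite and simple. An edge $(u,v)$ is butterfly contractible if it is the only edge with tail $u$ or the only edge with head $v$; a butterfly minor of $D$ is a digraph obtained from a subgraph of $D$ by contracting butterfly contractible edges. An abstract digraph decomposition of $D$ is a triple $(T,\beta,\gamma)$ with $T$ a rooted directed tree (edges directed away from the root), $\beta:V(T)\to 2^{V(D)}$, $\gamma:E(T)\to 2^{V(D)}$, $\bigcup_t\beta(t)=V(D)$. Let $\Gamma(t)=\beta(t)\cup\bigcup_{e\text{ incident with }t}\gamma(e)$, $T_t$ the subtree of nodes reachable from $t$, $\beta(T_t)=\bigcup_{t'\in V(T_t)}\beta(t')$; width $=\max_t |\Gamma(t)|-1$. An NCW-directed tree decomposition is an abstract digraph decomposition such that $\{\beta(t):t\in V(T)\}$ is a partition of $V(D)$ into nonempty sets, and for every edge $e=(s,t)\in E(T)$ there is no closed walk in $D-\gamma(e)$ containing a vertex of $\beta(T_t)$ and a vertex of $V(D)-\beta(T_t)$. $\mathrm{NCW}(D)$ is the minimum width of such a decomposition. *)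

(* Defs.v *)
From mathcomp Require Import all_boot.

Set Implicit Arguments.
Unset Strict Implicit.
Unset Printing Implicit Defensive.

(* Simple means no loops and no parallel arcs; a pair of antiparallel arcs
   (u, v), (v, u) is allowed. *)
Record digraph := Digraph {
  vertex :> finType;
  arc : rel vertex;
  arc_irrefl : irreflexive arc
}.

(* Up to isomorphism: an injective arc-preserving map. *)
Definition subdigraph (H D : digraph) : Prop :=
  exists2 f : H -> D, injective f & forall x y : H, arc x y -> arc (f x) (f y).

Definition butterfly_contractible (D : digraph) (u v : D) : Prop :=
  arc u v /\
  ((forall y : D, arc u y -> y = v) \/ (forall x : D, arc x v -> x = u)).

(* D' is, up to isomorphism, the simple digraph obtained from D by identifying
   u and v: f is the quotient map, and the loops and parallel arcs created by
   the identification are discarded. *)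
Definition contraction (D : digraph) (u v : D) (D' : digraph) : Prop :=
  exists f : D -> D',
    [/\ forall a : D', exists x : D, f x = a,
        forall x y : D,
          f x = f y <-> x = y \/ (x \in [set u; v] /\ y \in [set u; v])
      & forall a b : D',
          arc a b <-> a <> b /\ exists x y : D, [/\ f x = a, f y = b & arc x y]].

(* Each contracted arc is contractible in the digraph obtained so far. *)
Inductive butterfly_minor (D : digraph) : digraph -> Prop :=
| Butterfly_sub (H : digraph) : subdigraph H D -> butterfly_minor D H
| Butterfly_contract (H H' : digraph) (u v : H) :
    butterfly_minor D H -> butterfly_contractible u v -> contraction u v H' ->
    butterfly_minor D H'.

(* The existence and uniqueness of the walk from the root to each node say
   that the underlying graph is a tree with all arcs directed away from the
   root. *)
Record rooted_tree := RootedTree {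
  node :> finType;
  tree_arc : rel node;
  root : node;
  tree_walk : forall t : node,
    exists! p : seq node, path tree_arc root p /\ last root p = t
}.

(* guard (s, t) is only meaningful, and only used, when (s, t) is an arc of
   the tree. *)
Record decomposition (D : digraph) := Decomposition {
  tree : rooted_tree;
  bag : tree -> {set D};
  guard : tree * tree -> {set D};
  bag_cover : \bigcup_(t : tree) bag t = [set: D]
}.

Definition Gamma (D : digraph) (X : decomposition D) (t : tree X) : {set D} :=
  bag t :|: \bigcup_(e : tree X * tree X |
               tree_arc e.1 e.2 && ((e.1 == t) || (e.2 == t))) guard e.

Definition bag_below (D : digraph) (X : decomposition D) (t : tree X) : {set D} :=
  \bigcup_(t' : tree X | connect (@tree_arc (tree X)) t t') bag t'.

Definition width (D : digraph) (X : decomposition D) : nat := (\max_(t : tree X) #|Gamma t|).-1.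

Definition closed_walk_avoiding (D : digraph) (Z : {set D}) (c : seq D) : Prop :=
  cycle (@arc D) c /\ {in c, forall x, x \notin Z}.

(* Injectivity makes the bags a partition as an indexed family: distinct nodes
   have disjoint bags. *)
Definition NCW_decomposition (D : digraph) (X : decomposition D) : Prop :=
  [/\ injective (@bag D X),
      partition [set bag t | t : tree X] [set: D]
    & forall s t : tree X, tree_arc s t ->
        ~ exists c : seq D,
            [/\ closed_walk_avoiding (guard (s, t)) c,
                exists2 x, x \in c & x \in bag_below t
              & exists2 y, y \in c & y \in ~: bag_below t]].

(* A digraph without vertices has no NCW decomposition, because the root has a
   nonempty bag; so the minimum is a relation rather than a function. *)
Definition NCW (D : digraph) (k : nat) : Prop :=
  (exists2 X : decomposition D, NCW_decomposition X & width X = k) /\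
  (forall X : decomposition D, NCW_decomposition X -> k <= width X).

(* Main.v *)
From Stdlib Require Import Classical.
From mathcomp Require Import all_boot.
Require Import Defs.

(* D' has a spine 0..7 with all backward arcs and the forward arcs of length at
   most 3, and four gadgets: the digon X_j is entered from the triangle
   {j+2, j+3, j+4} and left towards j and j+4. By a haven argument, in a
   decomposition of width at most 3 each of the nine sets {i, .., i+3} and
   {j, j+2, j+3, j+4} is equal to some Gamma t. These nine nodes t need disjoint
   nonempty bags inside the eight spine vertices, which is impossible.
   D subdivides the arcs from X_3 to 3 by one new vertex, which is contracted
   into 3 to give D'. The new vertex serves as the ninth bag, so NCW(D) <= 3. *)

Set Implicit Arguments.
Unset Strict Implicit.
Unset Printing Implicit Defensive.

(** * Finite checks, trees given by parent functions, closed walks, existence of the minimum *)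

(** Turns a claim about ordinals into a closed boolean over [iota], so that the case checks on the
    concrete digraphs are settled by evaluation. *)
Lemma all_ord n (P : pred nat) : all P (iota 0 n) -> forall i : 'I_n, P i.
Proof. by move=> /allP h i; apply: h; rewrite mem_iota /= ltn_ord. Qed.

Lemma all_ord2 n m (P : nat -> nat -> bool) :
  all (fun i => all (P i) (iota 0 m)) (iota 0 n) ->
  forall (i : 'I_n) (j : 'I_m), P i j.
Proof. by move=> h i; apply: all_ord; apply: (all_ord h). Qed.

Definition ord_set n (l : seq nat) : {set 'I_n} := [set v : 'I_n | val v \in l].

Lemma card_ord_set n (l : seq nat) : #|ord_set n l| <= size l.
Proof.
rewrite cardE -(size_map val); apply: uniq_leq_size.
  by rewrite map_inj_uniq ?enum_uniq //; apply: val_inj.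
by move=> x /mapP[y]; rewrite mem_enum inE => yl ->.
Qed.

(* The junk value [par 0] is ignored: node 0 is the root. *)
Definition parent_arc n (par : nat -> nat) : rel 'I_n.+1 :=
  fun s t => (0 < t) && (par t == s).

(** Strong induction on [t]: the last arc of a walk to [t] must come from [par t], which is smaller,
    so walks to [t] are the walks to [par t] extended by [t]. *)
Lemma parent_walk n (par : nat -> nat) :
  (forall i : 'I_n.+1, 0 < i -> par i < i) ->
  forall t : 'I_n.+1,
    exists! p, path (parent_arc par) ord0 p /\ last ord0 p = t.
Proof.
move=> par_lt t; have [m] := ubnP (val t); elim: m t => // m IH t ltm.
have [t0|t_gt0] := posnP (val t).
  exists [::]; split=> [|p [pp pt]]; first by split=> //; apply: val_inj.
  case/lastP: p pp pt => // p x; rewrite rcons_path last_rcons => /andP[_].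
  by move=> /[swap] ->; rewrite /parent_arc t0.
have ltn : par t < n.+1 by apply: ltn_trans (ltn_ord t); apply: par_lt.
have [|p [[pp pt] up]] := IH (Ordinal ltn).
  by apply: leq_trans (par_lt _ t_gt0) _.
exists (rcons p t); split=> [|q [qq qt]].
  by rewrite rcons_path last_rcons pp pt /parent_arc t_gt0 /=.
case/lastP: q qq qt => [_ t0|q x]; first by rewrite -t0 in t_gt0.
rewrite rcons_path last_rcons => /andP[qq arcx] xt.
rewrite xt in arcx *; congr rcons; apply: up; split=> //.
by apply: val_inj; case/andP: arcx => _ /eqP parE; rewrite /= parE.
Qed.

Definition parent_tree n (par : nat -> nat)
    (par_lt : forall i : 'I_n.+1, 0 < i -> par i < i) : rooted_tree :=
  RootedTree (@parent_walk n par par_lt).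

(** Allows a closed formula for the descendant relation: it only has to satisfy the recursion along
    parents, which can be checked by evaluation. *)
Lemma connect_parent n (par : nat -> nat) (below : rel nat) :
  (forall i : 'I_n.+1, 0 < i -> par i < i) ->
  (forall s t : 'I_n.+1,
     below s t = (s == t :> nat) || (0 < t) && below s (par t)) ->
  forall s t : 'I_n.+1, connect (parent_arc par) s t = below s t.
Proof.
move=> par_lt belowE s t; have [m] := ubnP (val t); elim: m t => // m IH t ltm.
apply/idP/idP.
  move=> /connectP[p]; case/lastP: p => [_ ->|p x].
    by rewrite belowE eqxx.
  rewrite rcons_path last_rcons => /andP[pp arcx] tx; rewrite -tx in arcx.
  case/andP: arcx => t_gt0 /eqP parE.
  have ltp : last s p < m by rewrite -parE (leq_trans (par_lt _ t_gt0)).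
  rewrite belowE t_gt0 parE -IH //; apply/orP; right; apply/connectP.
  by exists p.
rewrite belowE => /orP[/eqP/val_inj ->|/andP[t_gt0 bl]]; first exact: connect0.
have ltn : par t < n.+1 by apply: ltn_trans (ltn_ord t); apply: par_lt.
apply: (@connect_trans _ _ (Ordinal ltn)).
  by rewrite IH //= (leq_trans (par_lt _ t_gt0)).
by apply: connect1; rewrite /parent_arc t_gt0 /=.
Qed.

Lemma closed_walk_stable (D : digraph) (Z B : {set D}) (c : seq D) x y :
  (forall u v : D, arc u v -> u \notin Z -> v \notin Z -> u \in B -> v \in B) ->
  closed_walk_avoiding Z c -> x \in c -> x \in B -> y \in c -> y \in B.
Proof.
move=> stab [cc cZ] xc xB yc.
case: (rot_to xc) => i c' rc.
have sub : {subset rcons c' x <= c}.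
  by move=> z; rewrite mem_rcons -rc mem_rot.
have : y \in x :: c' by rewrite -rc mem_rot.
have : path (@arc D) x (rcons c' x) by have := cc; rewrite -(rot_cycle i) rc.
(* The walk now starts and ends at [x]. Its end is generalized to [e], so that the induction can
   move the start alone. *)
move: xB xc sub; rewrite -cats1; move: [:: x] => e.
elim: c' x {rc} => [|z c' IH] x xB xc sub /=.
  by rewrite inE => _ /eqP ->.
case/andP=> xz pz; rewrite inE => /orP[/eqP -> //|].
have zc : z \in c by apply: sub; rewrite inE eqxx.
apply: IH => //; first by apply: stab xz _ _ xB; apply: cZ.
by move=> w wc; apply: sub; rewrite inE wc orbT.
Qed.

(** Descent on the width: by excluded middle, either a narrower decomposition exists or the present
    one is optimal. *)
Lemma NCW_exists (D : digraph) (X : decomposition D) :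
  NCW_decomposition X -> exists2 k, k <= width X & NCW D k.
Proof.
have [m] := ubnP (width X); elim: m X => // m IH X ltm ncwX.
have [[Y [ncwY ltY]]|no] := classic (exists Y : decomposition D,
    NCW_decomposition Y /\ width Y < width X).
  have [|k lek ncwk] := IH Y _ ncwY; first exact: leq_trans ltY _.
  by exists k => //; apply: leq_trans lek (ltnW ltY).
exists (width X) => //; split=> [|Y ncwY]; first by exists X.
by rewrite leqNgt; apply/negP => lt; apply: no; exists Y.
Qed.

(** * Havens in NCW decompositions *)

Section Decomposition_facts.

Context (D : digraph) (X : decomposition D) (ncwX : NCW_decomposition X).

Lemma bag_neq0 (t : tree X) : exists x, x \in bag t.
Proof.
case: ncwX => _ /and3P[_ _ n0] _; apply/set0Pn; apply: contra n0 => /eqP <-.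
by apply/imsetP; exists t.
Qed.

Lemma bag_inj (s t : tree X) x : x \in bag s -> x \in bag t -> s = t.
Proof.
case: ncwX => inj /and3P[_ tri _] _ xs xt; apply: inj; apply/eqP.
apply: contraTT xt => ne.
have /trivIsetP/(_ (bag s) (bag t)) := tri.
move=> /(_ (imset_f _ _) (imset_f _ _) ne) dis.
by rewrite (disjointFr (dis isT isT) xs).
Qed.

Lemma bag_sub_Gamma (t : tree X) : bag t \subset Gamma t.
Proof. exact: subsetUl. Qed.

Lemma guard_sub_Gamma (s t : tree X) :
  tree_arc s t -> guard (s, t) \subset Gamma s :&: Gamma t.
Proof.
move=> st; rewrite subsetI /Gamma; apply/andP; split.
  by apply: subsetU; rewrite (bigcup_sup (s, t)) ?orbT //= st eqxx.
by apply: subsetU; rewrite (bigcup_sup (s, t)) ?orbT //= st eqxx orbT.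
Qed.

(** A walk from [t] back to [s], appended to the root walk to [s] and the arc to [t], would be a
    second, longer root walk to [s]. *)
Lemma tree_acyclic (T : rooted_tree) (s t : T) :
  tree_arc s t -> ~~ connect (@tree_arc T) t s.
Proof.
move=> st; apply/connectP => -[q qq qs].
have [p [[pp ps] up]] := tree_walk s.
have := up (p ++ t :: q); rewrite cat_path last_cat ps /= st pp qq.
by move=> /(_ (conj isT (esym qs)))/(congr1 size)/eqP; rewrite size_cat -{1}[size p]addn0 eqn_add2l.
Qed.

(* A haven argument: follow [r t] down the tree, starting at the root; it
   never lies in the bag of the current node, so the descent never stops. *)
Lemma no_escape (r : tree X -> D) :
  (forall t, r t \notin Gamma t) ->
  (forall s t, tree_arc s t -> r s = r t \/
     exists c, [/\ closed_walk_avoiding (Gamma s :&: Gamma t) c,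
                   r s \in c & r t \in c]) -> False.
Proof.
move=> rG walk.
have inX x : exists t : tree X, x \in bag t.
  have : x \in \bigcup_(t : tree X) bag t by rewrite bag_cover inE.
  by case/bigcupP=> t _; exists t.
(* At the root this is absurd, since every bag lies below the root. *)
suff H (t : tree X) : r t \notin bag_below t.
  have /negP := H (root (tree X)); apply.
  have [h rh] := inX (r (root (tree X))); apply/bigcupP; exists h => //.
  have [p [[pp ph] _]] := tree_walk h.
  by apply/connectP; exists p.
have [m] := ubnP #|[set u | connect (@tree_arc (tree X)) t u]|.
elim: m t => // m IH s ltm; apply/negP => /bigcupP[h].
case/connectP=> -[_ ->|t q /= /andP[st tq] hE] rh.
  by have := rG s; rewrite (subsetP (bag_sub_Gamma s)).
have sb : r s \in bag_below t.
  by apply/bigcupP; exists h => //; apply/connectP; exists q.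
have /negP : r t \notin bag_below t.
  rewrite ltnS in ltm; apply: IH; apply: leq_trans ltm.
  apply: proper_card; apply/properP; split.
    apply/subsetP => u; rewrite !inE; apply: connect_trans; exact: connect1.
  by exists s; rewrite !inE ?connect0 // tree_acyclic.
(* If [r s] is below [t] and [r t] is not, the closed walk through both crosses the arc [(s, t)]. It
   avoids the guard, which lies in [Gamma s :&: Gamma t]. *)
apply; have [<- //|[c [[cc cZ] sc tc]]] := walk s t st.
apply/negPn/negP => tb.
case: ncwX => _ _ /(_ s t st); apply; exists c; split.
- split=> // x /cZ; apply: contra; apply: (subsetP (guard_sub_Gamma st)).
- by exists (r s).
- by exists (r t); rewrite // inE.
Qed.

Definition digon (u v : D) := arc u v && arc v u.

Lemma digon_walk (Z : {set D}) u v :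
  digon u v -> u \notin Z -> v \notin Z -> closed_walk_avoiding Z [:: u; v].
Proof.
move=> /andP[uv vu] uZ vZ; split; first by rewrite /= uv vu.
by move=> x; rewrite !inE => /orP[]/eqP ->.
Qed.

(** Otherwise each [Gamma t] misses a vertex of [l]. Two missed vertices are equal or form a digon,
    itself a closed walk avoiding the intersection, so these choices contradict [no_escape]. *)
Lemma clique_Gamma (l : seq D) :
  {in l &, forall u v, u = v \/ digon u v} ->
  exists t : tree X, {subset l <= Gamma t}.
Proof.
move=> cl.
have [[t ht]|no] := classic (exists t : tree X, {subset l <= Gamma t}); first by exists t.
have miss (t : tree X) : exists x, (x \in l) && (x \notin Gamma t).
  apply: NNPP => h; apply: no; exists t => x xl; apply/negPn/negP => xt.
  by apply: h; exists x; rewrite xl.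
exfalso; apply: (@no_escape (fun t => xchoose (miss t))).
  by move=> t; case/andP: (xchooseP (miss t)).
move=> s t _.
case/andP: (xchooseP (miss s)) => ul us; case/andP: (xchooseP (miss t)) => vl vt.
move: (xchoose (miss s)) (xchoose (miss t)) ul us vl vt => u v ul us vl vt.
have [->|uv] := cl _ _ ul vl; [by left | right].
exists [:: u; v]; split; rewrite ?inE ?eqxx ?orbT //.
by apply: digon_walk => //; rewrite in_setI negb_and ?us ?vt ?orbT.
Qed.

(* Unless [Gamma t] contains the triangle f1 f2 f3, it is avoided by one of
   its vertices; otherwise it is avoided by x or y, and by a. *)
Lemma gadget_Gamma (a f1 f2 f3 x y : D) :
  (forall t : tree X, #|Gamma t| <= 4) ->
  uniq [:: f1; f2; f3; x; y] ->
  {in [:: f1; f2; f3] &, forall u v, u = v \/ digon u v} -> digon x y ->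
  {in [:: x; y], forall w, [/\ digon f3 w, arc f1 w, arc f2 w & arc w a]} ->
  arc a f1 -> arc a f2 ->
  exists t : tree X, {subset [:: a; f1; f2; f3] <= Gamma t}.
Proof.
move=> small un tri xy wP af1 af2.
have [[t ht]|no] := classic (exists t : tree X, {subset [:: a; f1; f2; f3] <= Gamma t}); first by exists t.
exfalso.
pose F := [:: f1; f2; f3].
have miss (t : tree X) : exists v, (v \notin Gamma t) &&
   ((v \in F) || (v \in [:: x; y]) && (a \notin Gamma t)).
  have [/allP FG|/allPn[v vF vG]] := boolP (all (mem (Gamma t)) F); last first.
    by exists v; rewrite vG vF.
  have aG : a \notin Gamma t.
    apply/negP => aG; apply: no; exists t => v; rewrite inE => /orP[/eqP -> //|]; exact: FG.
  have [/allP WG|/allPn[v vW vG]] := boolP (all (mem (Gamma t)) [:: x; y]); last first.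
    by exists v; rewrite vG vW aG orbT.
  (* Five distinct vertices do not fit into [Gamma t]. *)
  have : size [:: f1; f2; f3; x; y] <= #|Gamma t|.
    rewrite cardE; apply: uniq_leq_size => // v.
    rewrite (mem_cat v F [:: x; y]) mem_enum => /orP[/FG|/WG] //.
  by rewrite leqNgt ltnS small.
(* The closed walk is the digon on [v] and [w] if [v = f3], and the directed triangle [v], [w], [a]
   otherwise; only the latter needs [a] outside [Z]. *)
have cross (Z : {set D}) v w : v \in F -> w \in [:: x; y] ->
    v \notin Z -> w \notin Z -> a \notin Z ->
    exists c, [/\ closed_walk_avoiding Z c, v \in c & w \in c].
  move=> vF wW vZ wZ aZ; have [f3w f1w f2w wa] := wP w wW.
  have : v = f3 \/ arc v w && arc a v.
    by move: vF; rewrite !inE => /or3P[]/eqP ->; rewrite ?f1w ?f2w; auto.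
  case=> [vf3|/andP[vw av]].
    exists [:: v; w]; split; rewrite ?inE ?eqxx ?orbT //.
    by apply: digon_walk; rewrite ?vf3 // -vf3.
  exists [:: v; w; a]; split; rewrite ?inE ?eqxx ?orbT //.
  split; first by rewrite /= vw wa av.
  by move=> z; rewrite !inE => /or3P[]/eqP ->.
apply: (@no_escape (fun t => xchoose (miss t))).
  by move=> t; case/andP: (xchooseP (miss t)).
move=> s t _.
case/andP: (xchooseP (miss s)) => us uc; case/andP: (xchooseP (miss t)) => vt vc.
move: (xchoose (miss s)) (xchoose (miss t)) us uc vt vc => u v us uc vt vc.
set Z := Gamma s :&: Gamma t.
have uZ : u \notin Z by rewrite inE negb_and us.
have vZ : v \notin Z by rewrite inE negb_and vt orbT.
have two : u = v \/ digon u v -> u = v \/ exists c,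
    [/\ closed_walk_avoiding Z c, u \in c & v \in c].
  case=> [|uv]; [by left | right; exists [:: u; v]].
  by split; rewrite ?inE ?eqxx ?orbT //; apply: digon_walk.
case/orP: uc => [uF|/andP[uW ua]]; case/orP: vc => [vF|/andP[vW va]].
- exact/two/tri.
- by right; apply: cross; rewrite // inE negb_and va orbT.
- have [|c [cZ vc uc]] := @cross Z v u vF uW vZ uZ; first by rewrite inE negb_and ua.
  by right; exists c.
- apply: two; move: uW vW; rewrite !inE.
  case/andP: xy => xy yx.
  by case/orP=> /eqP -> /orP[]/eqP ->; rewrite /digon ?xy ?yx; auto.
Qed.

End Decomposition_facts.

(** * The two digraphs and the contraction between them *)

(* The spine is 0..7; gadget X_j consists of 8 + 2j and 9 + 2j. *)
Definition ladder_arc : rel nat := fun v w =>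
  if v < 8 then
    if w < 8 then (v != w) && (w <= v + 3)
    else let j := (w - 8)./2 in j + 2 <= v <= j + 4
  else let j := (v - 8)./2 in
    if w < 8 then (w == j) || (w == j + 4)
    else (v != w) && ((w - 8)./2 == j).

(** The quotient map for contracting the arc from 8 to 3. Later vertices shift down by one, so in
    [ladder_sub] the gadget X_3 is {15, 16}. *)
Definition collapse (v : nat) : nat :=
  if v < 8 then v else if v == 8 then 3 else v.-1.

(* Vertex 8 is the subdividing vertex, and X_j becomes {9 + 2j, 10 + 2j}. *)
Definition ladder_sub_arc : rel nat := fun v w =>
  if v == 8 then w == 3
  else if w == 8 then 15 <= v
  else if (15 <= v) && (w == 3) then false
  else ladder_arc (collapse v) (collapse w).

Lemma ladder_irrefl : irreflexive (fun v w : 'I_16 => ladder_arc v w).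
Proof.
by move=> v; apply/negbTE; apply: (@all_ord 16 (fun v => ~~ ladder_arc v v)).
Qed.

Lemma ladder_sub_irrefl : irreflexive (fun v w : 'I_17 => ladder_sub_arc v w).
Proof.
by move=> v; apply/negbTE; apply: (@all_ord 17 (fun v => ~~ ladder_sub_arc v v)).
Qed.

Definition ladder : digraph := Digraph ladder_irrefl.
Definition ladder_sub : digraph := Digraph ladder_sub_irrefl.

Definition vtx (i : nat) : ladder := inord i : 'I_16.

Lemma ladder_minor : butterfly_minor ladder_sub ladder.
Proof.
have sub : butterfly_minor ladder_sub ladder_sub.
  by apply: Butterfly_sub; exists id.
apply: (@Butterfly_contract ladder_sub ladder_sub ladder
  (inord 8 : 'I_17) (inord 3 : 'I_17) sub).
  split; first by rewrite /arc /= !inordK.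
  (* The only arc with tail 8 goes to 3. *)
  by left=> y /=; rewrite !inordK // => /eqP y3; apply: val_inj; rewrite /= inordK.
have colK (v : 'I_17) : (inord (collapse v) : 'I_16) = collapse v :> nat.
  by rewrite inordK //; apply: (@all_ord 17 (fun v => collapse v < 16)).
exists (fun v : 'I_17 => inord (collapse v) : 'I_16); split.
- move=> a; have := @all_ord 16 (fun a => has (fun v => collapse v == a) (iota 0 17)) isT a.
  case/hasP=> v; rewrite mem_iota /= => lt /eqP va.
  by exists (inord v : 'I_17); apply: val_inj; rewrite /= colK inordK.
- move=> x y.
  have /eqP E := @all_ord2 17 17 (fun x y => (collapse x == collapse y) ==
    (x == y) || ((x == 8) || (x == 3)) && ((y == 8) || (y == 3))) isT x y.
  have inE8 (z : 'I_17) : (z \in [set (inord 8 : 'I_17); inord 3]) = (z == 8 :> nat) || (z == 3 :> nat).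
    by rewrite !inE -!val_eqE /= !inordK.
  split=> [/(congr1 val)|].
    rewrite /= !colK => /eqP; rewrite E => /orP[/eqP/val_inj|/andP[xs ys]]; first by left.
    by right; rewrite !inE8.
  move=> h; apply: val_inj; rewrite /= !colK; apply/eqP; rewrite E.
  by case: h => [->|[]]; rewrite ?eqxx // !inE8 => -> ->; rewrite orbT.
- move=> a b; split.
  + move=> ab.
    have := @all_ord2 16 16 (fun a b => ladder_arc a b ==> (a != b) &&
      has (fun x => has (fun y => [&& collapse x == a, collapse y == b & ladder_sub_arc x y])
        (iota 0 17)) (iota 0 17)) isT a b.
    move/implyP/(_ ab)/andP=> [ne /hasP[x xl /hasP[y yl /and3P[/eqP xa /eqP yb xy]]]].
    move: xl yl; rewrite !mem_iota /= => xl yl.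
    split; first by move=> E; rewrite E eqxx in ne.
    exists (inord x : 'I_17), (inord y : 'I_17); split; last by rewrite /arc /= !inordK.
      by apply: val_inj; rewrite /= colK inordK.
    by apply: val_inj; rewrite /= colK inordK.
  + case=> ne [x [y [xa yb xy]]].
    have := @all_ord2 17 17 (fun x y => ladder_sub_arc x y && (collapse x != collapse y)
      ==> ladder_arc (collapse x) (collapse y)) isT x y.
    rewrite /arc /= -xa -yb !colK => /implyP; apply; apply/andP; split=> //.
    by apply/negP => /eqP E; apply: ne; rewrite -xa -yb E.
Qed.

(** * A decomposition of [ladder_sub] of width at most 3 *)

(* The nodes 0..8 form a path, with bag {i} at node i; node 9 + j is a leaf
   attached to node 2j + 2, with bag X_j. *)
Definition dec_parent (t : nat) : nat := if t < 9 then t.-1 else (t - 9).*2 + 2.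

Definition dec_home (v : nat) : nat := if v < 9 then v else 9 + (v - 9)./2.

(* The guard of the tree arc that enters t. *)
Definition dec_guard (t : nat) : seq nat :=
  if t < 9 then [:: t./2 + 1; t./2 + 2; t./2 + 3]
  else let j := t - 9 in [:: (if j == 3 then 8 else j); j + 4].

Definition dec_below : rel nat := fun s t =>
  if s < 9 then if t < 9 then s <= t else s <= (t - 9).*2 + 2 else t == s.

(** An upper bound for [Gamma t]. Along the path it alternates between the sets {i, .., i+3} and {j,
    j+2, j+3, j+4}, with 8 in place of 3 at node 8; consecutive sets share the three vertices of the
    guard. *)
Definition dec_Gamma (t : nat) : seq nat :=
  if t == 0 then [:: 0; 1; 2; 3]
  else if t < 9 then
    let m := t./2 in
    if odd t then [:: m + 1; m + 2; m + 3; m + 4]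
    else [:: (if t == 8 then 8 else m.-1); m + 1; m + 2; m + 3]
  else [:: 9 + (t - 9).*2, 10 + (t - 9).*2 & dec_guard t].

Lemma dec_parent_lt (i : 'I_13) : 0 < i -> dec_parent i < i.
Proof. by apply/implyP; apply: (@all_ord 13 (fun i => (0 < i) ==> (dec_parent i < i))). Qed.

Definition dec_tree : rooted_tree := @parent_tree 12 dec_parent dec_parent_lt.

Definition dec_bag (t : dec_tree) : {set ladder_sub} :=
  [set v : 'I_17 | dec_home v == (t : 'I_13)].

Lemma dec_home_lt (v : 'I_17) : dec_home v < 13.
Proof. exact: (@all_ord 17 (fun v => dec_home v < 13)). Qed.

Lemma dec_cover : \bigcup_(t : dec_tree) dec_bag t = [set: ladder_sub].
Proof.
apply/setP => v; rewrite inE; apply/bigcupP.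
by exists (Ordinal (dec_home_lt v)); rewrite // inE.
Qed.

Definition dec : decomposition ladder_sub :=
  @Decomposition ladder_sub dec_tree dec_bag
    (fun e => ord_set 17 (dec_guard (e.2 : 'I_13))) dec_cover.

Lemma dec_belowE (s t : tree dec) :
  connect (@tree_arc dec_tree) s t = dec_below (s : 'I_13) (t : 'I_13).
Proof.
apply: (@connect_parent 12 dec_parent dec_below dec_parent_lt) => {}s {}t.
apply/eqP; apply: (@all_ord2 13 13 (fun s t =>
  dec_below s t == (s == t) || (0 < t) && dec_below s (dec_parent t))).
by vm_compute.
Qed.

Lemma dec_bag_below (t : tree dec) (v : 'I_17) :
  (v \in bag_below t) = dec_below (t : 'I_13) (dec_home v).
Proof.
apply/bigcupP/idP => [[s ts]|b].
  by rewrite inE => /eqP ->; rewrite -dec_belowE.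
by exists (Ordinal (dec_home_lt v)); rewrite ?dec_belowE ?inE.
Qed.

(** Once the guard of a tree arc is removed, all arcs between the part below and the rest point the
    same way, so no closed walk meets both sides. *)
Lemma dec_NCW : NCW_decomposition dec.
Proof.
have rep (t : 'I_13) : exists v : 'I_17, v \in dec_bag t.
  have := @all_ord 13 (fun t => has (fun v => dec_home v == t) (iota 0 17)) isT t.
  case/hasP=> v; rewrite mem_iota /= => lt vt.
  by exists (inord v); rewrite inE inordK.
split.
- move=> s t E; have [v vs] := rep s; have := vs; rewrite -[dec_bag s]/(bag s) E.
  move: vs; rewrite !inE => /eqP vs /eqP vt; apply: val_inj.
  by rewrite -[val s]vs -[val t]vt.
- apply/and3P; split.
  + rewrite cover_imset; apply/eqP; exact: dec_cover.
  + apply/trivIsetP => _ _ /imsetP[s _ ->] /imsetP[t _ ->] ne.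
    rewrite -setI_eq0; apply/eqP/setP => v; rewrite !inE.
    apply/negP => /andP[/eqP vs /eqP vt]; move/eqP: ne; apply; congr dec_bag.
    by apply: val_inj; rewrite -[val s]vs -[val t]vt.
  + apply/imsetP => -[t _ E]; have [v] := rep t.
    by rewrite -[dec_bag t]E inE.
pose cross t u v := [&& ladder_sub_arc u v, u \notin dec_guard t,
  v \notin dec_guard t & dec_below t (dec_home u) != dec_below t (dec_home v)].
(* For [b = true] every crossing arc leaves the part below [t]; for [b = false] every crossing arc
   enters it. *)
pose one_way b t := all (fun u => all (fun v =>
  cross t u v ==> (dec_below t (dec_home u) == b)) (iota 0 17)) (iota 0 17).
have ow (t : 'I_13) : 0 < t -> exists b, forall u v : 'I_17,
    cross t u v -> dec_below t (dec_home u) = b.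
  have /implyP h := @all_ord 13 (fun t => (0 < t) ==> one_way true t || one_way false t) isT t.
  by case/h/orP => ob; [exists true | exists false] => u v uv;
    have /implyP/(_ uv)/eqP := all_ord2 ob u v.
move=> s t /andP[t_gt0 _] [c [cw [x xc xb] [y yc]]]; rewrite inE => yb.
have [b bP] := ow t t_gt0.
have step (u v : ladder_sub) : arc u v -> u \notin guard (s, t) ->
    v \notin guard (s, t) -> (u \in bag_below t) != (v \in bag_below t) ->
    (u \in bag_below t) = b.
  move=> uv uZ vZ; rewrite !dec_bag_below => ne; apply: (bP u v).
  by move: uZ vZ; rewrite !inE => uZ vZ; apply/and4P.
(* Outside the guard, the complement of the part below is closed under arcs in the first case, and
   the part below itself in the second. *)
case: b {bP} step => step.
  have yB : y \in ~: bag_below t by rewrite inE.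
  suff : x \in ~: bag_below t by rewrite inE xb.
  apply: (closed_walk_stable _ cw yc yB xc) => u v uv uZ vZ.
  rewrite !inE => nu; apply/negP => vb.
  by have := step u v uv uZ vZ; rewrite vb (negbTE nu) => /(_ isT).
apply: (negP yb); apply: (closed_walk_stable _ cw xc xb yc) => u v uv uZ vZ ub.
apply/negPn/negP => nv.
by have := step u v uv uZ vZ; rewrite ub (negbTE nv) => /(_ isT).
Qed.

Lemma dec_width : width dec <= 3.
Proof.
have small (t : tree dec) : #|Gamma t| <= 4.
  apply: leq_trans (_ : size (dec_Gamma (t : 'I_13)) <= 4); last first.
    exact: (@all_ord 13 (fun t => size (dec_Gamma t) <= 4)).
  apply: leq_trans (card_ord_set 17 _); apply/subset_leq_card/subsetP => v.
  rewrite !inE => /orP[/eqP vt|/bigcupP[[s t'] /= /andP[/andP[t_gt0 /eqP par_t'] stt]]].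
    have := @all_ord 17 (fun v => v \in dec_Gamma (dec_home v)) isT v.
    by rewrite vt.
  rewrite inE => vg.
  (* The guard of the arc entering [t'] lies in the bounding sets of both ends of that arc. *)
  have /allP/(_ (val v)) := @all_ord 13 (fun t' => all (fun v => (0 < t') && (v \in dec_guard t') ==>
    (v \in dec_Gamma t') && (v \in dec_Gamma (dec_parent t'))) (iota 0 17)) isT t'.
  rewrite mem_iota /= ltn_ord t_gt0 vg /= => /(_ isT)/andP[g1 g2].
  by case/orP: stt => /eqP <-; rewrite // -par_t'.
have : \max_(t : tree dec) #|Gamma t| <= 4 by apply/bigmax_leqP => t _.
by rewrite /width; case: (\max_(t : tree dec) _).
Qed.

(** * The lower bound for [ladder] *)

(** Indices 0 to 4 give the cliques of consecutive spine vertices, and index 5 + m gives the set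
    forced by gadget X_m. *)
Definition forced (j : nat) : seq nat :=
  if j < 5 then [:: j; j + 1; j + 2; j + 3]
  else [:: j - 5; j - 3; j - 2; j - 1].

Lemma ladder_arcE (v w : nat) :
  v < 16 -> w < 16 -> @arc ladder (vtx v) (vtx w) = ladder_arc v w.
Proof. by move=> lv lw; rewrite /arc /= !inordK. Qed.

Lemma ladder_width (X : decomposition ladder) : NCW_decomposition X -> 3 < width X.
Proof.
move=> ncwX; rewrite ltnNge; apply/negP => w3.
have small (t : tree X) : #|Gamma t| <= 4.
  apply: (@leq_trans (\max_(t : tree X) #|Gamma t|)).
    exact: (leq_bigmax (F := fun t => #|Gamma t|)).
  by move: w3; rewrite /width; case: (\max_(t : tree X) _).
have ex (j : 'I_9) : exists t : tree X, {subset map vtx (forced j) <= Gamma t}.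
  have [j5|j5] := ltnP j 5.
    apply: (clique_Gamma ncwX) => _ _ /mapP[v vl ->] /mapP[w wl ->].
    have /allP/(_ v vl)/allP/(_ w wl) := @all_ord 9 (fun j => all (fun v => all (fun w =>
      (j < 5) ==> [&& v < 16, w < 16 & (v == w) || ladder_arc v w && ladder_arc w v])
        (forced j)) (forced j)) isT j.
    rewrite j5 => /and3P[lv lw /orP[/eqP ->|vw]]; first by left.
    by right; rewrite /digon !ladder_arcE.
  have [m mj m4] : exists2 m, j = m + 5 :> nat & m < 4.
    by exists (j - 5); rewrite ?subnK // ltn_subLR // ltn_ord.
  have -> : forced j = [:: m; m + 2; m + 3; m + 4].
    by rewrite mj; case: m m4 {mj} => [|[|[|[|]]]].
  have vtx_uniq l : all (fun v => v < 16) l -> uniq l -> uniq (map vtx l).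
    move=> /allP l16 ul; rewrite map_inj_in_uniq // => v w /l16 lv /l16 lw.
    by move/(congr1 val); rewrite /= !inordK.
  (* Here [a] is m, the triangle is m+2, m+3, m+4 with [f3] equal to m+4, and the digon is X_m. *)
  apply: (@gadget_Gamma _ _ ncwX _ _ _ _ (vtx (8 + m.*2)) (vtx (9 + m.*2)) small).
  - apply: (vtx_uniq [:: m + 2; m + 3; m + 4; 8 + m.*2; 9 + m.*2]);
      by case: m m4 {mj} => [|[|[|[|]]]].
  - move=> u v; case: m m4 {mj} => [|[|[|[|]]]] // _;
      rewrite !inE => /or3P[]/eqP -> /or3P[]/eqP ->;
      by [left | right; rewrite /digon !ladder_arcE].
  - by case: m m4 {mj} => [|[|[|[|]]]] // _; rewrite /digon !ladder_arcE.
  - move=> w; case: m m4 {mj} => [|[|[|[|]]]] // _;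
      by rewrite !inE => /orP[]/eqP ->; split; rewrite /digon ?ladder_arcE.
  - by case: m m4 {mj} => [|[|[|[|]]]] // _; rewrite ladder_arcE.
  - by case: m m4 {mj} => [|[|[|[|]]]] // _; rewrite ladder_arcE.
have [t tP] := fin_all_exists ex.
(* Four distinct forced vertices inside a set of size at most four leave no room for others, so the
   bag of [t j] stays on the spine. *)
have GammaE j : Gamma (t j) =i map vtx (forced j).
  have := @all_ord 9 (fun j => [&& uniq (forced j), size (forced j) == 4 &
     all (fun v => v < 16) (forced j)]) isT j.
  case/and3P=> uj /eqP sj /allP lj v.
  have uj' : uniq (map vtx (forced j)).
    rewrite map_inj_in_uniq // => x y /lj lx /lj ly.
    by move/(congr1 val); rewrite /= !inordK.
  have sub : {subset map vtx (forced j) <= enum (Gamma (t j))}.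
    by move=> x /tP; rewrite mem_enum.
  have le : size (enum (Gamma (t j))) <= size (map vtx (forced j)).
    by rewrite -cardE size_map sj small.
  by have [_ ->] := uniq_min_size uj' sub le; rewrite mem_enum.
have [v vP] := fin_all_exists (fun j => bag_neq0 ncwX (t j)).
have vl (j : 'I_9) : exists2 w, w \in forced j & v j = vtx w.
  have : v j \in Gamma (t j) by apply: (subsetP (bag_sub_Gamma _)).
  by rewrite GammaE => /mapP[w wl ->]; exists w.
have lt8 (j : 'I_9) w : w \in forced j -> w < 8.
  by move: w; apply/allP; exact: (@all_ord 9 (fun j => all (fun w => w < 8) (forced j))).
(* No forced set contains another one, so one node cannot serve two indices. *)
have t_inj (i j : 'I_9) : t i = t j -> i = j.
  move=> tij; apply/eqP; apply: contraT => ne.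
  have := @all_ord2 9 9 (fun i j => (i != j) ==> has (fun w => w \notin forced j) (forced i)) isT i j.
  case/implyP/(_ ne)/hasP=> w wi; case/negP.
  have : vtx w \in Gamma (t j) by rewrite -tij; apply/tP/map_f.
  rewrite GammaE => /mapP[w' wj /(congr1 val)].
  by rewrite /= !inordK ?(leq_trans (lt8 _ _ wi)) ?(leq_trans (lt8 _ _ wj)) // => ->.
(* Pigeonhole: one vertex from each of the nine disjoint bags would inject nine indices into the
   eight spine vertices. *)
have inj : injective (fun j : 'I_9 => inord (v j : 'I_16) : 'I_8).
  move=> i j; have [wi wil vi] := vl i; have [wj wjl vj] := vl j.
  have li := lt8 _ _ wil; have lj := lt8 _ _ wjl.
  move=> /(congr1 val); rewrite vi vj /= (inordK (leq_trans li _)) //.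
  rewrite (inordK (leq_trans lj _)) // !inordK // => wij.
  by apply: t_inj; apply: (bag_inj ncwX (vP i)); rewrite vi wij -vj.
by have := leq_card _ inj; rewrite !card_ord.
Qed.

(** * Conclusion *)

(** Serves only to show that [ladder] has an NCW decomposition, hence a minimum width; the given
    vertex makes the single bag nonempty. *)
Lemma one_bag (D : digraph) : D -> exists X : decomposition D, NCW_decomposition X.
Proof.
move=> x0.
have par_lt (i : 'I_1) : 0 < i -> 0 < i by [].
pose T := @parent_tree 0 (fun=> 0) par_lt.
have cov : \bigcup_(t : T) [set: D] = [set: D].
  by apply/setP => x; rewrite inE; apply/bigcupP; exists ord0; rewrite ?inE.
exists (@Decomposition D T (fun=> setT) (fun=> set0) cov); split.
- by move=> s t _; rewrite [s]ord1 [t]ord1.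
- apply/and3P; split.
  + by rewrite cover_imset; apply/eqP.
  + apply/trivIsetP => _ _ /imsetP[s _ ->] /imsetP[t _ ->]; by rewrite eqxx.
  + by apply/imsetP => -[t _ /setP/(_ x0)]; rewrite !inE.
- by move=> s t /andP[]; rewrite [t]ord1.
Qed.

Theorem theorem4p11 :
  exists (D D' : digraph) (k k' : nat),
    [/\ butterfly_minor D D', NCW D k, NCW D' k' & k < k'].
Proof.
have [X ncwX] := one_bag (vtx 0).
have [k' _ Dk'] := NCW_exists ncwX.
have [k lek Dk] := NCW_exists dec_NCW.
exists ladder_sub, ladder, k, k'; split=> //; first exact: ladder_minor.
have [[Y ncwY <-] _] := Dk'.
exact: leq_ltn_trans (leq_trans lek dec_width) (ladder_width ncwY).
Qed.
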